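(* For any $m_1\neq m_2\in\Gamma_N$ and any $s>0$, there exist absolute constants $k_1,k_2>0$ such that $$\mathbb{P}_J\left(\frac{Z_{\beta,N}\,\mathrm{cap}(\mathcal{S}_N[m_1],\mathcal{S}_N[m_2])}{\tilde Z_{\beta,N}\,\mathrm{cap}^{\mathrm{CW}}(\mathcal{S}_N[m_1],\mathcal{S}_N[m_2])}\ge\mathrm{e}^{-(s+2\beta(1+h)+\alpha)}(1+o(1))\right)\ge1-k_1\mathrm{e}^{-k_2s^2},$$ asymptotically as $N\to\infty$, where $\alpha=\frac{\beta^2(1-p)}{4p}$.
   Context: $p\in(0,1)$ is fixed, $\beta\in(0,\infty)$ is the inverse temperature and $h>0$ is a constant external magnetic field. $\mathcal{S}_N=\{-1,+1\}^N$; $(J_{ij})_{1\le i<j\le N}$ are i.i.d. Bernoulli($p$), $J_{ji}=J_{ij}$, with joint law $\mathbb{P}_J$. The randomly dilute Curie--Weiss Hamiltonian is $H_N(\sigma)=-\frac1{Np}\sum_{i<j}J_{ij}\sigma_i\sigma_j-h\sum_i\sigma_i$; the Curie--Weiss (CW) Hamiltonian is $\tilde H_N(\sigma)=-\frac1N\sum_{i<j}\sigma_i\sigma_j-h\sum_i\sigma_i$ (the $J$-mean of $H_N$). Gibbs measures: $\mu_{\beta,N}(\sigma)=\mathrm{e}^{-\beta H_N(\sigma)}/Z_{\beta,N}$, $Z_{\beta,N}=\sum_\sigma\mathrm{e}^{-\beta H_N(\sigma)}$; $\tilde\mu_{\beta,N}(\sigma)=\mathrm{e}^{-\beta\tilde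 H_N(\sigma)}/\tilde Z_{\beta,N}$, $\tilde Z_{\beta,N}=\sum_\sigma\mathrm{e}^{-\beta\tilde H_N(\sigma)}$. Given $J$, the Metropolis chain on $\mathcal{S}_N$ has transition probabilities $p_N(\sigma,\sigma')=\frac1N\exp(-\beta[H_N(\sigma')-H_N(\sigma)]_+)$ if $\sigma,\sigma'$ differ in exactly one spin, $p_N(\sigma,\sigma)=1-\sum_{\eta\neq\sigma}p_N(\sigma,\eta)$, and $0$ otherwise, where $[x]_+=\max(x,0)$; $\mathbb{P}_\sigma$ is its (quenched) law started at $\sigma$. The CW chain is defined identically with $\tilde H_N$ in place of $H_N$. Hitting times: $\tau_A=\inf\{t>0:\sigma(t)\in A\}$. For disjoint $A,B\subset\mathcal{S}_N$ the capacity is $\mathrm{cap}(A,B)=\sum_{\sigma\in A}\mu_{\beta,N}(\sigma)\mathbb{P}_\sigma(\tau_B<\tau_A)$, and $\mathrm{cap}^{\mathrm{CW}}(A,B)$ is the same quantity for the CW chain and $\tilde\mu_{\beta,N}$. $m(\sigma)=\frac1N\sum_i\sigma_i\in\Gamma_N=\{-1,-1+\frac2N,\dots,1\}$ and $\mathcal{S}_N[m]=\{\sigma\in\mathcal{S}_N:m(\sigma)=m\}$.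
   Formalization: The constants k1, k2 are not absolute: they may depend on p and β (but not on h, s, m1, m2, N), since fully absolute constants are impossible (take m1=1, m2=1-2/N, α=s→∞). *)

(* Defs.v *)
From HB Require Import structures.
From mathcomp Require Import all_boot all_order all_algebra.
From mathcomp Require Import mathcomp_extra boolp classical_sets functions.
From mathcomp Require Import cardinality fsbigop reals ereal topology.
From mathcomp Require Import normedtype sequences exp measure lebesgue_measure.
From mathcomp Require Import random_variable bernoulli_distribution.
From mathcomp Require Import lra.

Set Implicit Arguments.
Unset Strict Implicit.
Unset Printing Implicit Defensive.

Import Order.TTheory GRing.Theory Num.Theory.
Import numFieldNormedType.Exports.

Local Open Scope classical_set_scope.
Local Open Scope ring_scope.

(* [true] encodes the spin +1 and [false] the spin -1, see [spin] *)
Definition configuration (N : nat) := {ffun 'I_N -> bool}.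

HB.instance Definition _ N := Finite.on (configuration N).
HB.instance Definition _ N :=
  isPointed.Build (configuration N) [ffun=> true].

Definition bond (N : nat) := {ij : 'I_N * 'I_N | (ij.1 < ij.2)%N}.

Definition couplings (N : nat) := {ffun bond N -> bool}.

Section model.
Context {R : realType} {N : nat}.
Implicit Types (s : configuration N) (J : couplings N) (p h beta m : R).

Definition PJ p (E : pred (couplings N)) : R :=
  \sum_(J | E J) \prod_(e : bond N) bernoulli_pmf p (J e).

Definition spin s (i : 'I_N) : R := if s i then 1 else -1.

Definition H_dilute p h J s : R :=
  - ((N%:R * p)^-1 *
     \sum_(e : bond N) (J e)%:R * spin s (val e).1 * spin s (val e).2)
  - h * \sum_i spin s i.

Definition H_CW h s : R :=
  - (N%:R^-1 * \sum_(e : bond N) spin s (val e).1 * spin s (val e).2)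
  - h * \sum_i spin s i.

Definition magnetization s : R := N%:R^-1 * \sum_i spin s i.

Definition magnetization_level m : {set configuration N} :=
  [set s | magnetization s == m]%SET.

End model.
Arguments H_CW {R} N h s.
Arguments magnetization_level {R} N m.

Definition Gamma {R : realType} (N : nat) : set R :=
  [set m | exists2 k : nat, (k <= N)%N & m = -1 + k%:R * (2 / N%:R)].

Section dynamics.
Context {R : realType} {N : nat}.
Variables (beta : R) (H : configuration N -> R).
Implicit Types s t : configuration N.

Definition partition_function : R := \sum_s expR (- (beta * H s)).

Definition gibbs s : R := expR (- (beta * H s)) / partition_function.

Definition one_flip s t : bool := #|[set i | s i != t i]%SET| == 1%N.

Definition metropolis_offdiag s t : R :=
  if one_flip s t then
    N%:R^-1 * expR (- (beta * Num.max (H t - H s) 0))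
  else 0.

Definition metropolis s t : R :=
  if s == t then 1 - \sum_(u | u != s) metropolis_offdiag s u
  else metropolis_offdiag s t.

End dynamics.

(* generators of the product sigma-algebra *)
Definition coordinate_sets (N : nat) : set (set (nat -> configuration N)) :=
  [set A | exists n s, A = [set v | v n = s]].

Definition trajectory (N : nat) := g_sigma_algebraType (@coordinate_sets N).

Section chain.
Context {R : realType} {N : nat}.
Local Notation S := (configuration N).
Implicit Types (q : S -> S -> R) (x : S).

Definition is_chain_law q x (P : probability (trajectory N) R) : Prop :=
  forall n (w : nat -> S),
    P [set v : trajectory N | forall k, (k <= n)%N -> v k = w k] =
    ((w 0 == x)%:R * \prod_(0 <= k < n) q (w k) (w k.+1))%:E.

(* [is_chain_law q x] determines [P] uniquely, and by [chain_lawP] below it has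
   a solution for every stochastic [q]; the default value (the Dirac mass at a
   constant trajectory) is thus never used for such a [q] *)
Definition chain_law q x : probability (trajectory N) R :=
  match pselect (exists P, is_chain_law q x P) with
  | left exP => projT1 (cid exP)
  | right _ => @dirac _ (trajectory N) (fun=> x) R
  end.

(* +oo when [A] is never visited at a positive time *)
Definition hitting_time (A : {set S}) (v : trajectory N) : \bar R :=
  ereal_inf [set (t%:R)%:E | t in [set t : nat | (0 < t)%N /\ v t \in A]].

End chain.

Definition capacity {R : realType} {N : nat} (beta : R)
    (H : configuration N -> R) (A B : {set configuration N}) : R :=
  \sum_(s in A) gibbs beta H s *
    fine (chain_law (metropolis beta H) s
      [set v | (hitting_time B v < hitting_time A v :> \bar R)%E]).

Section existence.
Context {R : realType} {N : nat}.
Local Notation S := (configuration N).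
Variable q : S -> S -> R.
Hypothesis q_ge0 : forall x y, 0 <= q x y.
Hypothesis q_sum1 : forall x, \sum_y q x y = 1.

(* The chain is driven by a single uniform variable on [0, 1[: from [x], the
   unit interval is cut into consecutive intervals of lengths [q x y], and the
   relative position inside the selected interval is used for the next step. *)
Let cum (x : S) (k : nat) : R := \sum_(z : S | (enum_rank z < k)%N) q x z.

Let low (x y : S) : R := cum x (enum_rank y).

Let cumS x y : cum x (enum_rank y).+1 = low x y + q x y.
Proof.
rewrite /low /cum (bigD1 y)//= addrC; congr (_ + _); apply: eq_bigl => z.
by rewrite ltnS ltn_neqAle andbC -(inj_eq enum_rank_inj).
Qed.

Let cum_le x k l : (k <= l)%N -> cum x k <= cum x l.
Proof.
move=> kl; rewrite /cum [leRHS](bigID (fun z : S => (enum_rank z < k)%N))/=.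
have -> : \sum_(z : S | (enum_rank z < l)%N && (enum_rank z < k)%N) q x z =
          \sum_(z : S | (enum_rank z < k)%N) q x z.
  by apply: eq_bigl => z; apply/andb_idl => /leq_trans; exact.
by rewrite lerDl; apply: sumr_ge0.
Qed.

Let low_ge0 x y : 0 <= low x y.
Proof. exact: sumr_ge0. Qed.

Let cum1 x : cum x #|S| = 1.
Proof. by rewrite -(q_sum1 x); apply: eq_bigl => z; rewrite ltn_ord. Qed.

Let low_le1 x y : low x y + q x y <= 1.
Proof. by rewrite -cumS -(cum1 x); apply: cum_le; exact: ltn_ord. Qed.

Let slot x u y := low x y <= u < low x y + q x y.

Let slot_ex x u : 0 <= u < 1 -> exists y, slot x u y.
Proof.
move=> /andP[u0 u1].
have : exists k, u < cum x k by exists #|S|; rewrite cum1.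
move=> /ex_minnP[k uk kmin].
case: k uk kmin => [|k] uk kmin.
  by move: uk; rewrite /cum big_pred0// ltNge u0.
have kS : (k < #|S|)%N by apply: kmin; rewrite cum1.
pose y : S := enum_val (Ordinal kS).
have yk : enum_rank y = k :> nat by rewrite enum_valK.
exists y; rewrite /slot -cumS /low yk uk andbT leNgt.
by apply/negP => /kmin; rewrite ltnn.
Qed.

Let slot_lt x u y z : slot x u y -> slot x u z -> ~ (enum_rank y < enum_rank z)%N.
Proof.
move=> /andP[_ h1] /andP[h2 _] /(cum_le x); rewrite cumS -/(low x z) => h3.
by have := lt_le_trans h1 (le_trans h3 h2); rewrite ltxx.
Qed.

Let slot_inj x u y z : slot x u y -> slot x u z -> y = z.
Proof.
move=> hy hz; apply: enum_rank_inj; apply/val_inj.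
have [yz|zy|//] := ltngtP (enum_rank y) (enum_rank z).
- by have := slot_lt hy hz yz.
- by have := slot_lt hz hy zy.
Qed.

Let next (x : S) (u : R) : S := odflt x [pick y | slot x u y].

Let nextP x u y : 0 <= u < 1 -> (next x u = y) <-> slot x u y.
Proof.
move=> u01; rewrite /next; case: pickP => [z hz|/= h]; last first.
  by have [z hz] := slot_ex x u01; have := h z; rewrite hz.
by split=> [<-//|hy]; exact: slot_inj hz hy.
Qed.

Let rem (x : S) (u : R) : R := (u - low x (next x u)) / q x (next x u).

Let rem_itv x u : 0 <= u < 1 -> 0 <= rem x u < 1.
Proof.
move=> u01; have /(nextP x _ u01) : next x u = next x u by [].
rewrite /rem /slot; move: (next x u) => y /andP[h1 h2].
have q0 : 0 < q x y by lra.
by rewrite divr_ge0 ?subr_ge0//= ltr_pdivrMr// mul1r ltrBlDl.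
Qed.

Let clip (u : R) : R := if 0 <= u < 1 then u else 0.

Let Fixpoint traj (n : nat) (x : S) (u : R) : S :=
  if n is n'.+1 then traj n' (next x u) (rem x u) else x.

Let traj_itv n : forall x (w : nat -> S), w 0 = x ->
  exists2 a, 0 <= a /\ a + \prod_(0 <= k < n) q (w k) (w k.+1) <= 1 &
    forall u, 0 <= u < 1 ->
      (forall k, (k <= n)%N -> traj k x u = w k) <->
      a <= u < a + \prod_(0 <= k < n) q (w k) (w k.+1).
Proof.
elim: n => [|n IH] x w w0.
  exists 0; first by rewrite big_geq// add0r.
  move=> u u01; rewrite big_geq// add0r u01; split=> // _ k.
  by rewrite leqn0 => /eqP ->.
have [a [a0 a1] ha] := IH (w 1%N) (w \o succn) erefl.
rewrite big_nat_recl//= w0.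
set W := \prod_(0 <= k < n) _ in a1 ha *.
have W0 : 0 <= W by apply: prodr_ge0.
set c := q x (w 1%N); set l := low x (w 1%N).
have c0 : 0 <= c by exact: q_ge0.
have l0 : 0 <= l by exact: low_ge0.
have l1 : l + c <= 1 by exact: low_le1.
exists (l + c * a).
  split; first by rewrite addr_ge0// mulr_ge0.
  by rewrite -addrA -mulrDr (le_trans _ l1)// lerD2l ler_piMr.
move=> u u01.
have step : (forall k, (k <= n.+1)%N -> traj k x u = w k) <->
   next x u = w 1%N /\ forall k, (k <= n)%N -> traj k (w 1%N) (rem x u) = w k.+1.
  split=> [h|[h1 h2] [_|k kn]//=]; last by rewrite h1 h2.
  have h1 : next x u = w 1%N by exact: (h 1%N).
  by split=> // k kn; have := h k.+1 kn; rewrite /= h1.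
apply: (iff_trans step); split.
  move=> [h1 /(ha _ (rem_itv x u01))].
  have /(nextP _ _ u01)/andP[] := h1; rewrite /rem h1 -/l -/c => lu ulc.
  have cp : 0 < c by lra.
  rewrite ler_pdivlMr// ltr_pdivrMr// => /andP[h2 h3].
  by apply/andP; split; lra.
move=> /andP[h2 h3].
have cW : 0 < c * W by lra.
have cp : 0 < c.
  by rewrite lt_neqAle c0 andbT; apply/eqP => ce; move: cW; rewrite -ce mul0r ltxx.
have ca : 0 <= c * a by rewrite mulr_ge0.
have caW : c * (a + W) <= c by rewrite ler_piMr.
have h1 : next x u = w 1%N.
  apply/(nextP _ _ u01); rewrite /slot -/l -/c; apply/andP; split; first by lra.
  by move: caW; rewrite mulrDr; lra.
split=> //; apply/(ha _ (rem_itv x u01)).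
rewrite /rem h1 -/l -/c ler_pdivlMr// ltr_pdivrMr//; apply/andP; split; lra.
Qed.

Let D : set (measurableTypeR R) := `[0, 1[%classic.

Let mD : measurable D.
Proof. exact: measurable_itv. Qed.

Let mrestr_D := mrestr (@lebesgue_measure R) mD : set (measurableTypeR R) -> \bar R.

HB.instance Definition _ := Measure.on mrestr_D.

Let mrestr_DT : mrestr_D setT = 1%E.
Proof.
rewrite /mrestr_D /mrestr/= setTI /D lebesgue_measure_itv/= lte_fin ltr01.
by rewrite -EFinB subr0.
Qed.

HB.instance Definition _ :=
  Measure_isProbability.Build _ _ _ mrestr_D mrestr_DT.

Variable x : S.

Let path (u : measurableTypeR R) : trajectory N := fun n => traj n x (clip u).

Let prefix n (w : nat -> S) :=
  D `&` [set u | forall k, (k <= n)%N -> path u k = w k].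

Let prefixE n (w : nat -> S) : exists2 a,
  w 0 = x -> 0 <= a /\ a + \prod_(0 <= k < n) q (w k) (w k.+1) <= 1 &
  prefix n w = if w 0 == x then
    `[a, a + \prod_(0 <= k < n) q (w k) (w k.+1)[%classic else set0.
Proof.
case: eqP => [w0|w0]; last first.
  exists 0 => //; apply/seteqP; split=> // u [_ /(_ 0)]; rewrite /path/= => h.
  by apply: w0; rewrite h.
have [a [a0 a1] h] := traj_itv n w0; exists a => //.
apply/seteqP; split=> u /=.
  rewrite /prefix/= /D/= !in_itv/= => -[u01].
  by rewrite /path /clip u01 => /(h _ u01).
rewrite /prefix /D/= !in_itv/= => uW.
have u01 : 0 <= u < 1.
  by move: uW => /andP[h1 h2]; apply/andP; split; lra.
by split=> //; rewrite /path /clip u01; apply/(h _ u01).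
Qed.

Let measurable_prefix n w : measurable (prefix n w).
Proof. by have [a _ ->] := prefixE n w; case: ifP. Qed.

Let measurable_path : measurable_fun [set: measurableTypeR R] path.
Proof.
have mE : @measurable _ (trajectory N) = <<s @coordinate_sets N >> by [].
apply: (measurability _ mE).
move=> _ [_ [n [y ->]] <-]; rewrite setTI.
set A := path @^-1` _.
have -> : A = (D `&` A) `|` (~` D `&` A) by rewrite -setIUl setUv setTI.
apply: measurableU.
  pose ext (t : {ffun 'I_n.+1 -> S}) k := t (inord k).
  have -> : D `&` A = \bigcup_(t in
      [set t : {ffun 'I_n.+1 -> S} | t ord_max = y]) prefix n (ext t).
    apply/seteqP; split=> u /=.
      move=> [Du Au]; exists [ffun k : 'I_n.+1 => path u k].
        by rewrite /= ffunE; exact: Au.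
      by split=> // k kn; rewrite /ext ffunE inordK.
    move=> [t /= ty [Du /(_ n (leqnn n))]]; rewrite /ext => h; split=> //.
    rewrite /A/= h -ty; congr (t _); apply/val_inj => /=.
    by rewrite inordK.
  by apply: fin_bigcup_measurable => [|t _]; [exact: finite_finset|].
have [h|h] := pselect (traj n x 0 = y).
  suff -> : ~` D `&` A = ~` D by exact: measurableC.
  apply/seteqP; split=> u /=; first by case.
  move=> Du; split=> //; rewrite /A/= /path /clip.
  by case: ifPn => // u01; exfalso; apply: Du; rewrite /D/= in_itv.
suff -> : ~` D `&` A = set0 by [].
apply/seteqP; split=> u //= [Du]; rewrite /A/= /path /clip.
by case: ifPn => // u01 _; apply: Du; rewrite /D/= in_itv.
Qed.

Let mpath : {mfun (measurableTypeR R) >-> (trajectory N)} :=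
  mfun_Sub (mem_set measurable_path).

Lemma is_chain_law_ex : exists P, is_chain_law q x P.
Proof.
exists (distribution mrestr_D mpath) => n w.
rewrite /distribution/= /pushforward /mrestr_D /mrestr/= setIC.
have [a h] := prefixE n w; rewrite /prefix => ->.
case: eqP h => [w0 /(_ w0) [a0 a1]|_ _]; last first.
  by rewrite measure0 mul0r.
have W0 : 0 <= \prod_(0 <= k < n) q (w k) (w k.+1) by apply: prodr_ge0.
rewrite lebesgue_measure_itv/= lte_fin mul1r ltrDl lt_neqAle W0 andbT.
case: eqP => [<-//|_].
by rewrite -EFinB addrC addKr.
Qed.

Lemma chain_lawP : is_chain_law q x (chain_law q x).
Proof.
rewrite /chain_law; case: pselect => [exP|]; first by case: cid.
by move/(_ is_chain_law_ex).
Qed.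

End existence.

Lemma metropolis_ge0 (R : realType) (N : nat) (beta : R)
    (H : configuration N -> R) (s t : configuration N) :
  0 <= beta -> 0 <= metropolis beta H s t.
Proof.
move=> beta0; rewrite /metropolis; case: eqP => _; last first.
  by rewrite /metropolis_offdiag; case: ifP => // _; rewrite mulr_ge0 ?expR_ge0.
rewrite subr_ge0.
pose flip (i : 'I_N) : configuration N :=
  [ffun j => if j == i then ~~ s j else s j].
have off_le u : metropolis_offdiag beta H s u <=
    \sum_(i < N) (u == flip i)%:R * N%:R^-1.
  rewrite /metropolis_offdiag; case: ifPn => [/cards1P[i si]|_]; last first.
    by rewrite sumr_ge0// => i _; rewrite mulr_ge0.
  have -> : u = flip i.
    apply/ffunP => j; rewrite ffunE.
    have -> : (j == i) = (s j != u j) by rewrite -(finset.in_set1 j i) -si inE.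
    by case: (s j) (u j) => -[].
  rewrite (bigD1 i)//= eqxx mul1r -[leLHS]addr0 lerD//; last first.
    by rewrite sumr_ge0// => j _; rewrite mulr_ge0.
  rewrite ler_piMr// -expR0 ler_expR oppr_le0 mulr_ge0//.
  by rewrite le_max lexx orbT.
apply: (@le_trans _ _ (\sum_u \sum_(i < N) (u == flip i)%:R * N%:R^-1)).
  rewrite big_mkcond/=; apply: ler_sum => u _; case: ifP => // _.
  by rewrite sumr_ge0// => i _; rewrite mulr_ge0.
rewrite exchange_big/= (eq_bigr (fun=> N%:R^-1)); last first.
  move=> i _; rewrite (bigD1 (flip i))//= eqxx mul1r big1 ?addr0// => u.
  by move=> /negbTE ->; rewrite mul0r.
rewrite sumr_const card_ord -(mulr_natr N%:R^-1).
have [->|N0] := eqVneq N 0%N; first by rewrite mulr0.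
by rewrite mulVf// pnatr_eq0.
Qed.

Lemma metropolis_sum1 (R : realType) (N : nat) (beta : R)
    (H : configuration N -> R) (s : configuration N) :
  \sum_t metropolis beta H s t = 1.
Proof.
rewrite (bigD1 s)//= {1}/metropolis eqxx.
rewrite [X in _ + X](eq_bigr (metropolis_offdiag beta H s)) ?subrK//.
by move=> t; rewrite /metropolis eq_sym => /negbTE ->.
Qed.

Lemma metropolis_chain_lawP (R : realType) (N : nat) (beta : R)
    (H : configuration N -> R) (s : configuration N) : 0 <= beta ->
  is_chain_law (metropolis beta H) s (chain_law (metropolis beta H) s).
Proof.
move=> beta0; apply: chain_lawP => [x y|x].
- exact: metropolis_ge0.
- exact: metropolis_sum1.
Qed.

(* Main.v *)
Require Import Defs.
From mathcomp Require Import all_boot all_order all_algebra.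
From mathcomp Require Import boolp classical_sets reals topology normedtype.
From mathcomp Require Import sequences exp.
From mathcomp Require Import fsbigop cardinality ereal measure.
From mathcomp Require Import bernoulli_distribution.
From mathcomp Require Import ring lra.
Import Order.TTheory GRing.Theory Num.Theory.
Import numFieldNormedType.Exports.
Local Open Scope classical_set_scope.
Local Open Scope ring_scope.
Set Implicit Arguments.
Unset Strict Implicit.
Unset Printing Implicit Defensive.

(** Multiplied by its partition function, the capacity of a reversible chain is
the energy of an electrical network whose conductances are the Gibbs weights
times the transition probabilities. For the Metropolis dynamics the edge [s, t]
has conductance [exp (- beta max (H s, H t)) / N], so the dilute and the
Curie--Weiss networks differ on each edge by the factor
[exp (beta (max (H s, H t) - max (H' s, H' t)))], which is at most
[exp (beta max (D s, D t))] for the deviation [D = H - H'].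

Sending the current of the Curie--Weiss network through the dilute one bounds
the ratio of the two normalized capacities below by [1 / X], where [X] is the
average of these factors against the share of the Curie--Weiss energy carried by
each edge ([flux_comparison], [capacity_comparison]). These shares are
deterministic: the randomness sits only in [D], which is linear in the
couplings. That the hitting probabilities in the definition of the capacity
are a potential of the network is first-step analysis of the chain
([hitting_prob_step]).

It remains to bound the upper tail of [X]. With [a = alpha] of the theorem and
[k >= 1] not depending on [N], the moment generating function of centred
Bernoulli variables gives [E exp (k beta D s) <= exp (k^2 a + o(1))], because
there are about [N^2 / 2] bonds, each with a coefficient of size
[beta k / (N p)]. Only the order [N] bonds at the flipped spin separate [D t]
from [D s], so the maximum of the two costs no more than a factor
[exp (2 k beta)] when [N] is large ([H_deviation_max_mgf]). By convexity these
[k]-th moments pass to the average [X], and Markov's inequality bounds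
[P (X > exp T)], where [T = s + 2 beta (1 + h) + a], by
[exp (k^2 a + 2 k beta - k T)]; at [k = 1 + s / (2 a)] this is at most
[exp (- s^2 / (4 a))]. So [k1 = 1] and [k2 = 1 / (4 a)] work, even with the
error term [o(1)] equal to [0]. *)

(** * First-step analysis of the hitting probabilities *)

Section first_step_analysis.
Context {R : realType} {N : nat}.
Local Notation S := (configuration N).
Variables (q : S -> S -> R) (A B : {set S}).

(** The starting point is kept apart from the list of the later positions,
because hitting times ignore the position at time [0]. *)
Fixpoint path_weight (x : S) (w : seq S) : R :=
  if w is y :: w' then q x y * path_weight y w' else 1.

(** Recursion on the path is what makes the first-step decomposition of the
hitting probability a definitional unfolding. *)
Fixpoint reaches_first (w : seq S) : bool :=
  if w is y :: w' then (y \notin A) && ((y \in B) || reaches_first w')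
  else false.

Lemma reaches_firstP (v : nat -> S) n :
  reaches_first (mkseq v n) <->
  exists2 i, (i < n)%N /\ v i \in B & forall j, (j <= i)%N -> v j \notin A.
Proof.
elim: n v => [|n IH] v; first by split => // -[i []].
have -> : mkseq v n.+1 = v 0 :: mkseq (v \o succn) n.
  by rewrite /mkseq/= (iotaDl 1 0) -map_comp.
rewrite /=; split.
- move=> /andP[v0A /orP[v0B|/IH[i [ltin viB] notA]]].
  + by exists 0; [|move=> j; rewrite leqn0 => /eqP ->].
  + exists i.+1; first by [].
    by case=> [|j] // ji; exact: notA.
- move=> [i [ltin viB] notA]; rewrite notA//=.
  case: i ltin viB notA => [|i] ltin viB notA; first by rewrite viB.
  by apply/orP; right; apply/IH; exists i => // j ji; exact: notA.
Qed.

Lemma path_weight_prod x y (w : seq S) :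
  \prod_(0 <= k < size w) q (nth x (y :: w) k) (nth x (y :: w) k.+1) =
  path_weight y w.
Proof.
elim: w y => [|z w IH] y /=; first by rewrite big_geq.
by rewrite big_nat_recl//= -IH.
Qed.

Lemma sum_tuple_cons n (F : seq S -> R) :
  \sum_(w : n.+1.-tuple S) F w = \sum_y \sum_(w : n.-tuple S) F (y :: w).
Proof.
rewrite pair_bigA/=.
rewrite (reindex (fun u : S * n.-tuple S => [tuple of u.1 :: u.2])) //=.
exists (fun w => (thead w, [tuple of behead w])) => [[y w] _|w _].
- by congr (_, _); apply/val_inj.
- by rewrite -tuple_eta.
Qed.

Lemma path_weight_sum1 n x : (forall y, \sum_z q y z = 1) ->
  \sum_(w : n.-tuple S) path_weight x w = 1.
Proof.
move=> q1; elim: n x => [|n IH] x.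
  rewrite (bigD1 [tuple])//= big1 ?addr0// => w.
  by case/eqP; apply/val_inj; case: w => -[].
rewrite (sum_tuple_cons _ (path_weight x)) -(q1 x).
by apply: eq_bigr => y _; rewrite /= -mulr_sumr IH mulr1.
Qed.

Lemma measurable_coordinate n y :
  measurable ([set v | v n = y] : set (trajectory N)).
Proof. by apply: sub_gen_smallest; exists n, y. Qed.

Lemma measurable_cylinder n (w : nat -> S) :
  measurable ([set v | forall k, (k <= n)%N -> v k = w k] : set (trajectory N)).
Proof.
have -> : [set v | forall k, (k <= n)%N -> v k = w k] =
    \bigcap_(k in [set k | (k <= n)%N]) [set v : trajectory N | v k = w k].
  by apply/seteqP; split => v /= h k; exact: h.
apply: bigcap_measurable; first by exists 0.
by move=> k _; exact: measurable_coordinate.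
Qed.

Variable x : S.
Variable P : probability (trajectory N) R.
Hypothesis Plaw : is_chain_law q x P.

Let cyl n (u : S * n.-tuple S) : set (trajectory N) :=
  [set v | forall k, (k <= n)%N -> v k = nth x (u.1 :: u.2) k].

Let cylE n (u : S * n.-tuple S) :
  P (cyl u) = ((u.1 == x)%:R * path_weight u.1 u.2)%:E.
Proof.
by rewrite Plaw/=; congr (_ * _)%:E; rewrite -(path_weight_prod x) size_tuple.
Qed.

Let finite_dim_set n (G : pred (seq S)) :
  [set v : trajectory N | G (mkseq (fun k => v k.+1) n)] =
  \bigcup_(u in [set` [seq u : S * n.-tuple S <- enum {: S * n.-tuple S} | G u.2]]) cyl u.
Proof.
apply/seteqP; split => v /=.
- move=> Gv; exists (v 0, [tuple of mkseq (fun k => v k.+1) n]) => /=.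
    by rewrite mem_filter/= Gv mem_enum.
  by case=> [|k] //= kn; rewrite nth_mkseq.
- move=> [[y w]] /=; rewrite mem_filter/= => /andP[Gw _] h.
  suff -> : mkseq (fun k => v k.+1) n = w by [].
  apply: (@eq_from_nth _ x); rewrite size_mkseq ?size_tuple// => k kn.
  by rewrite nth_mkseq// h.
Qed.

Lemma measurable_finite_dim n (G : pred (seq S)) :
  measurable [set v : trajectory N | G (mkseq (fun k => v k.+1) n)].
Proof.
rewrite finite_dim_set; apply: fin_bigcup_measurable.
  exact: finite_seq.
by move=> u _; exact: measurable_cylinder.
Qed.

(** The law of a chain is given on prefixes; an event on the times [1] to [n]
is the finite disjoint union of the prefixes compatible with it, among which
those not starting at [x] are null. *)
Lemma chain_law_finite_dim n (G : pred (seq S)) :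
  P [set v : trajectory N | G (mkseq (fun k => v k.+1) n)] =
  (\sum_(w : n.-tuple S) (G w)%:R * path_weight x w)%:E.
Proof.
rewrite finite_dim_set measure_fin_bigcup; first last.
- by move=> u _; exact: measurable_cylinder.
- move=> [y w] [y' w'] _ _ [v [/= h h']].
  have e k : (k <= n)%N -> nth x (y :: w) k = nth x (y' :: w') k.
    by move=> kn; rewrite -h// h'.
  congr (_, _); first exact: (e 0).
  apply/val_inj/(@eq_from_nth _ x); rewrite !size_tuple// => k kn.
  exact: (e k.+1).
- exact: finite_seq.
rewrite -fsbig_seq; last by rewrite filter_uniq ?enum_uniq.
rewrite big_filter.
rewrite (eq_bigr _ (fun u _ => cylE u)).
rewrite sumEFin; congr EFin; rewrite big_enum_cond/=.
rewrite -(pair_big_dep xpredT (fun _ (w : n.-tuple S) => G w)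
  (fun y w => (y == x)%:R * path_weight y w))/=.
rewrite (bigD1 x)//= [X in _ + X]big1 ?addr0; last first.
  by move=> y /negbTE yx; rewrite big1// => w _; rewrite yx mul0r.
rewrite big_mkcond/=; apply: eq_bigr => w _; rewrite eqxx mul1r.
by case: (G w); rewrite ?mul1r ?mul0r.
Qed.

(** This removes the infima over infinite sets of times: [B] is hit first as
soon as some finite piece of the trajectory shows it. *)
Lemma hitting_time_lt (v : trajectory N) :
  (hitting_time B v < hitting_time A v :> \bar R)%E <->
  exists n, reaches_first (mkseq (fun k => v k.+1) n).
Proof.
split.
- move=> /ereal_inf_lt[_ [t /= [t0 vtB] <-]] tA; exists t.
  case: t t0 vtB tA => // t _ vtB tA; apply/reaches_firstP; exists t => //.
  move=> j jt; apply/negP => vjA; move: tA; apply/negP; rewrite -leNgt.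
  apply: (@le_trans _ _ (j.+1%:R)%:E); last by rewrite lee_fin ler_nat.
  by apply: ereal_inf_lbound; exists j.+1.
- move=> [n /reaches_firstP[i [_ viB] notA]].
  apply: (@le_lt_trans _ _ (i.+1%:R)%:E).
    by apply: ereal_inf_lbound; exists i.+1.
  apply: (@lt_le_trans _ _ (i.+2%:R)%:E); first by rewrite lte_fin ltr_nat.
  apply/ereal_infP => _ [[|t] /= [// _ vtA] <-].
  rewrite lee_fin ler_nat ltnS ltnNge; apply/negP => ti.
  by move: (notA _ ti); rewrite vtA.
Qed.

(** Continuity from below, along the increasing events that [B] has been
reached first by time [n]. *)
Lemma hitting_prob_cvg :
  (\sum_(w : n.-tuple S) (reaches_first w)%:R * path_weight x w) @[n --> \oo]
  --> fine (P [set v | (hitting_time B v < hitting_time A v :> \bar R)%E]).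
Proof.
pose F n : set (trajectory N) :=
  [set v | reaches_first (mkseq (fun k => v k.+1) n)].
have mF n : measurable (F n) by exact: measurable_finite_dim.
have -> : [set v | (hitting_time B v < hitting_time A v :> \bar R)%E] =
    \bigcup_n F n.
  apply/seteqP; split => v /=.
  - by move=> /hitting_time_lt[n vn]; exists n.
  - by move=> [n _ vn]; apply/hitting_time_lt; exists n.
have ndF : nondecreasing_seq F.
  move=> n m nm; apply/subsetPset => v /reaches_firstP[i [ltin viB] notA].
  by apply/reaches_firstP; exists i => //; split => //; exact: leq_trans nm.
have mUF : measurable (\bigcup_n F n) by exact: bigcup_measurable.
have -> : (fun n => \sum_(w : n.-tuple S)
    (reaches_first w)%:R * path_weight x w) = fine \o (P \o F).
  by apply/funext => n /=; rewrite chain_law_finite_dim.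
apply: fine_cvg; rewrite fineK ?fin_num_measure//.
exact: nondecreasing_cvg_mu.
Qed.

End first_step_analysis.

Section equilibrium_potential.
Context {R : realType} {N : nat}.
Local Notation S := (configuration N).
Variables (q : S -> S -> R) (A B : {set S}).
Hypothesis q_ge0 : forall x y, 0 <= q x y.
Hypothesis q_sum1 : forall x, \sum_y q x y = 1.

Definition hitting_prob (x : S) : R := fine (chain_law q x
  [set v | (hitting_time B v < hitting_time A v :> \bar R)%E]).

Definition equilibrium_potential (x : S) : R :=
  if x \in A then 0 else if x \in B then 1 else hitting_prob x.

(** Markov property at time [1]. It is exact for finite horizons by unfolding
path weights, and the horizon then tends to infinity on both sides. *)
Lemma hitting_prob_step x :
  hitting_prob x = \sum_y q x y * equilibrium_potential y.
Proof.
pose U n x := \sum_(w : n.-tuple S) (reaches_first A B w)%:R * path_weight q x w.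
have cvgU y : U n y @[n --> \oo] --> hitting_prob y.
  by apply: hitting_prob_cvg; exact: chain_lawP.
pose V n y := if y \in A then 0 else if y \in B then 1 else U n y.
have cvgV y : V n y @[n --> \oo] --> equilibrium_potential y.
  rewrite /V /equilibrium_potential.
  case: ifP => _; first exact: cvg_cst.
  by case: ifP => _; [exact: cvg_cst|exact: cvgU].
have UV n : U n.+1 x = \sum_y q x y * V n y.
  rewrite /U (sum_tuple_cons _ (fun w => (reaches_first A B w)%:R * path_weight q x w)).
  apply: eq_bigr => y _; rewrite /V /=.
  case: ifP => yA /=.
    by rewrite mulr0 big1// => w _; rewrite mul0r.
  case: ifP => yB /=.
    under eq_bigr do rewrite mul1r.
    by rewrite -mulr_sumr path_weight_sum1.
  by rewrite /U mulr_sumr; apply: eq_bigr => w _; rewrite mulrCA.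
have h1 : U n.+1 x @[n --> \oo] --> hitting_prob x.
  by rewrite (cvg_shiftS (U ^~ x)); exact: cvgU.
have h2 : U n.+1 x @[n --> \oo] --> \sum_y q x y * equilibrium_potential y.
  under eq_fun do rewrite UV.
  by apply: cvg_big => [|y _]; [exact: add_continuous|apply: cvgMr; exact: cvgV].
exact: (cvg_unique _ h1 h2).
Qed.

End equilibrium_potential.

(** * Comparison of electrical networks *)

Section dirichlet_form.
Context {R : realFieldType} {S : finType}.
Implicit Types (c r : S -> S -> R) (f g : S -> R) (A B : {set S}).

Definition dirichlet c f g : R :=
  \sum_x \sum_y c x y * (f y - f x) * (g y - g x).

Definition flux c A g : R := \sum_(x in A) \sum_y c x y * (g y - g x).

Lemma dirichlet_by_parts c f g : (forall x y, c x y = c y x) ->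
  dirichlet c f g = - 2 * \sum_x f x * \sum_y c x y * (g y - g x).
Proof.
move=> c_sym.
have -> : dirichlet c f g = \sum_x \sum_y c x y * f y * (g y - g x)
    - \sum_x \sum_y c x y * f x * (g y - g x).
  rewrite /dirichlet -sumrB; apply: eq_bigr => x _.
  by rewrite -sumrB; apply: eq_bigr => y _; ring.
have -> : \sum_x \sum_y c x y * f y * (g y - g x) =
    - \sum_x \sum_y c x y * f x * (g y - g x).
  rewrite exchange_big/= -sumrN; apply: eq_bigr => x _.
  by rewrite -sumrN; apply: eq_bigr => y _; rewrite (c_sym y x); ring.
have -> : \sum_x f x * (\sum_y c x y * (g y - g x)) =
    \sum_x \sum_y c x y * f x * (g y - g x).
  by apply: eq_bigr => x _; rewrite mulr_sumr; apply: eq_bigr => y _; ring.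
by ring.
Qed.

(** Summation by parts kills the interior, where [g] is harmonic, and turns the
boundary values of [f] into the current of [g] out of [A]. The shift of [f] by
[1], which does not change the energy, moves its zeros from [A] to [B]. The
result is the same for all admissible [f]: it will be used for [f = g], and for
[f] the potential of another network. *)
Lemma dirichlet_flux c A B f g : (forall x y, c x y = c y x) ->
  (forall x, x \in A -> f x = 0) -> (forall x, x \in B -> f x = 1) ->
  (forall x, x \notin A -> x \notin B -> \sum_y c x y * (g y - g x) = 0) ->
  dirichlet c f g = 2 * flux c A g.
Proof.
move=> c_sym fA fB gharm.
have -> : dirichlet c f g = dirichlet c (fun x => f x - 1) g.
  by apply: eq_bigr => x _; apply: eq_bigr => y _; ring.
rewrite dirichlet_by_parts// mulNr -mulrN -sumrN; congr (2 * _).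
rewrite /flux [RHS]big_mkcond/=; apply: eq_bigr => x _.
case: ifPn => xA; first by rewrite fA// sub0r mulN1r opprK.
have [xB|xB] := boolP (x \in B); first by rewrite fB// subrr mul0r oppr0.
by rewrite gharm// mulr0 oppr0.
Qed.

(** The mixed energy of [f] and [g] in the network [c'] equals the flux of [g],
by [dirichlet_flux]; Cauchy--Schwarz splits it between the energy of [f] for [c]
and the energy of [g] for [r * c']. This is Thomson's principle for the network
[c] with the current of the network [c'] as trial flow. *)
Lemma flux_comparison c c' r A B f g :
  (forall x y, 0 <= c x y) -> (forall x y, c x y = c y x) ->
  (forall x y, c' x y = c' y x) ->
  (forall x y, 0 < r x y) -> (forall x y, c' x y = r x y * c x y) ->
  (forall x, x \in A -> f x = 0) -> (forall x, x \in B -> f x = 1) ->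
  (forall x, x \in A -> g x = 0) -> (forall x, x \in B -> g x = 1) ->
  (forall x, x \notin A -> x \notin B -> \sum_y c x y * (f y - f x) = 0) ->
  (forall x, x \notin A -> x \notin B -> \sum_y c' x y * (g y - g x) = 0) ->
  let w x y := c' x y * (g y - g x) ^+ 2 / (2 * flux c' A g) in
  0 < flux c' A g ->
  [/\ forall x y, 0 <= w x y, \sum_x \sum_y w x y = 1 &
    flux c' A g <= (\sum_x \sum_y w x y * r x y) * flux c A f].
Proof.
move=> c_ge0 c_sym c'_sym r_gt0 c'E fA fB gA gB fharm gharm w.
set C' := flux c' A g; set C := flux c A f => C'0.
set X := \sum_x \sum_y w x y * r x y.
have c'_ge0 x y : 0 <= c' x y by rewrite c'E mulr_ge0// ltW.
have w_ge0 x y : 0 <= w x y.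
  by rewrite /w divr_ge0//; [rewrite mulr_ge0 ?sqr_ge0|rewrite mulr_ge0// ltW].
have Dgg : \sum_x \sum_y c' x y * (g y - g x) ^+ 2 = 2 * C'.
  rewrite -(dirichlet_flux c'_sym gA gB gharm); apply: eq_bigr => x _.
  by apply: eq_bigr => y _; rewrite mulrA.
have w_sum1 : \sum_x \sum_y w x y = 1.
  under eq_bigr do rewrite -mulr_suml.
  by rewrite -mulr_suml Dgg divff// gt_eqF// mulr_gt0.
split => //.
have Dfg : \sum_x \sum_y c' x y * (f y - f x) * (g y - g x) = 2 * C'.
  exact: (dirichlet_flux c'_sym fA fB gharm).
have Dff : \sum_x \sum_y c x y * (f y - f x) ^+ 2 = 2 * C.
  rewrite -(dirichlet_flux c_sym fA fB fharm); apply: eq_bigr => x _.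
  by apply: eq_bigr => y _; rewrite mulrA.
have wr_ge0 x y : 0 <= w x y * r x y.
  exact: mulr_ge0 (w_ge0 x y) (ltW (r_gt0 x y)).
have X0 : 0 < X.
  have X_ge0 : 0 <= X.
    by apply: sumr_ge0 => x _; apply: sumr_ge0 => y _; exact: wr_ge0.
  rewrite lt_neqAle X_ge0 andbT eq_sym; apply/eqP => XE.
  have w0 x y : w x y = 0.
    apply/eqP; move/eqP: XE.
    rewrite psumr_eq0 => [|z _]; last first.
      by apply: sumr_ge0 => t _; exact: wr_ge0.
    move=> /allP/(_ x); rewrite mem_index_enum => /(_ erefl)/=.
    rewrite psumr_eq0 => [|z _]; last exact: wr_ge0.
    move=> /allP/(_ y); rewrite mem_index_enum => /(_ erefl)/=.
    by rewrite mulf_eq0 (gt_eqF (r_gt0 x y)) orbF.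
  move: w_sum1; rewrite big1 => [/eqP|x _]; first by rewrite eq_sym oner_eq0.
  by rewrite big1.
have XE : \sum_x \sum_y r x y * c' x y * (g y - g x) ^+ 2 = 2 * C' * X.
  rewrite /X mulr_sumr; apply: eq_bigr => x _.
  rewrite mulr_sumr; apply: eq_bigr => y _; rewrite /w -/C'.
  by field; rewrite gt_eqF.
(* Cauchy--Schwarz by Young's inequality, edge by edge. With the parameter X the
   first sum on the right is 2 C', half of the left-hand side 4 C'. *)
have le1 : \sum_x \sum_y 2 * (c' x y * (f y - f x) * (g y - g x)) <=
    \sum_x \sum_y (X^-1 * (r x y * c' x y * (g y - g x) ^+ 2)
                   + X * (c x y * (f y - f x) ^+ 2)).
  apply: ler_sum => x _; apply: ler_sum => y _.
  rewrite -subr_ge0 !c'E.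
  have -> : X^-1 * (r x y * (r x y * c x y) * (g y - g x) ^+ 2) +
      X * (c x y * (f y - f x) ^+ 2) -
      2 * (r x y * c x y * (f y - f x) * (g y - g x)) =
      c x y / X * (r x y * (g y - g x) - X * (f y - f x)) ^+ 2.
    by field; rewrite gt_eqF.
  by rewrite mulr_ge0 ?sqr_ge0// divr_ge0// ltW.
move: le1; under eq_bigr do rewrite -mulr_sumr.
rewrite -mulr_sumr Dfg.
under eq_bigr do rewrite big_split/= -!mulr_sumr.
rewrite big_split/= -!mulr_sumr XE Dff.
have -> : X^-1 * (2 * C' * X) = 2 * C' by field; rewrite gt_eqF.
by lra.
Qed.

End dirichlet_form.

(** * Capacities of the Metropolis chain *)

Section metropolis_capacity.
Context {R : realType} {N : nat}.
Local Notation S := (configuration N).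
Implicit Types (H : S -> R) (q : S -> S -> R) (A B : {set S}) (s t : S).
Variable beta : R.
Hypothesis beta_gt0 : 0 < beta.

Definition conductance H (s t : S) : R :=
  if one_flip s t then N%:R^-1 * expR (- (beta * Num.max (H s) (H t))) else 0.

Lemma one_flip_sym s t : @one_flip N s t = one_flip t s.
Proof.
rewrite /one_flip; congr (_ == _); apply: eq_card => i.
by rewrite !inE eq_sym.
Qed.

Lemma one_flip_irrefl s : @one_flip N s s = false.
Proof.
by rewrite /one_flip eq_card0// => i; rewrite !inE eqxx.
Qed.

Lemma conductance_sym H s t : conductance H s t = conductance H t s.
Proof. by rewrite /conductance one_flip_sym maxC. Qed.

Lemma conductance_ge0 H s t : 0 <= conductance H s t.
Proof.
by rewrite /conductance; case: ifP => // _; rewrite mulr_ge0 ?expR_ge0.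
Qed.

(** Detailed balance of the Metropolis rates: the left-hand side is symmetric. *)
Lemma conductanceE H s t :
  conductance H s t = expR (- (beta * H s)) * metropolis_offdiag beta H s t.
Proof.
rewrite /conductance /metropolis_offdiag; case: ifP => _; last by rewrite mulr0.
rewrite mulrCA -expRD; congr (_ * expR _).
rewrite -opprD -mulrDr addr_maxr addr0 subrKC.
by rewrite maxC.
Qed.

(** One identity for both uses of the first-step equation. Outside [A] and [B]
the right-hand side vanishes, which is harmonicity; on [A] it is the summand of
the capacity. *)
Lemma equilibrium_potential_flux H A B s :
  \sum_t conductance H s t *
    (equilibrium_potential (metropolis beta H) A B t
     - equilibrium_potential (metropolis beta H) A B s) =
  expR (- (beta * H s)) * (hitting_prob (metropolis beta H) A B s
     - equilibrium_potential (metropolis beta H) A B s).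
Proof.
set q := metropolis beta H; set e := equilibrium_potential q A B.
have q0 x y : 0 <= q x y by apply: metropolis_ge0; exact: ltW.
have q1 x : \sum_y q x y = 1 by exact: metropolis_sum1.
have -> : hitting_prob q A B s - e s = \sum_t q s t * (e t - e s).
  rewrite (hitting_prob_step A B q0 q1).
  under [RHS]eq_bigr do rewrite mulrBr.
  by rewrite sumrB -mulr_suml q1 mul1r.
rewrite mulr_sumr; apply: eq_bigr => t _; rewrite conductanceE /q /metropolis.
case: eqP => [->|_]; last by rewrite mulrA.
by rewrite subrr !mulr0.
Qed.

Lemma partition_function_gt0 H : 0 < partition_function beta H.
Proof.
rewrite /partition_function (bigD1 [ffun=> true])//= ltr_wpDr ?expR_gt0//.
by rewrite sumr_ge0// => s _; exact: expR_ge0.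
Qed.

Lemma capacity_flux H A B : partition_function beta H * capacity beta H A B =
  flux (conductance H) A (equilibrium_potential (metropolis beta H) A B).
Proof.
rewrite /capacity mulr_sumr; apply: eq_bigr => s sA.
rewrite equilibrium_potential_flux [X in _ - X]/equilibrium_potential sA subr0.
rewrite /gibbs mulrA; congr (_ * _).
by rewrite mulrCA mulfV ?mulr1// gt_eqF// partition_function_gt0.
Qed.

Lemma equilibrium_potential0 q A B s :
  s \in A -> equilibrium_potential q A B s = 0.
Proof. by rewrite /equilibrium_potential => ->. Qed.

Lemma equilibrium_potential1 q A B s : [disjoint A & B]%B ->
  s \in B -> equilibrium_potential q A B s = 1.
Proof.
move=> AB sB; rewrite /equilibrium_potential sB.
by rewrite (disjointFl AB sB).
Qed.

Lemma equilibrium_potential_harmonic H A B s :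
  s \notin A -> s \notin B ->
  \sum_t conductance H s t *
    (equilibrium_potential (metropolis beta H) A B t
     - equilibrium_potential (metropolis beta H) A B s) = 0.
Proof.
move=> /negbTE sA /negbTE sB; rewrite equilibrium_potential_flux.
by rewrite /equilibrium_potential sA sB subrr mulr0.
Qed.

(** Single flips connect all configurations: the spins of [a] are replaced by
those of [b] one index at a time. *)
Lemma one_flip_invariant_const (g : S -> R) :
  (forall s t, one_flip s t -> g s = g t) -> forall a b, g a = g b.
Proof.
move=> gflip a b.
pose path k : S := [ffun i : 'I_N => if (i < k)%N then b i else a i].
have path0 : path 0 = a by apply/ffunP => i; rewrite ffunE.
have pathN : path N = b by apply/ffunP => i; rewrite ffunE ltn_ord.
rewrite -path0 -pathN; elim: {-2}N (leqnn N) => // k IH kN.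
rewrite IH ?(ltnW kN)//.
have [->//|ne] := eqVneq (path k) (path k.+1).
apply: gflip; apply/cards1P; exists (Ordinal kN).
have d i : i != Ordinal kN -> path k i = path k.+1 i.
  by rewrite -val_eqE/= !ffunE ltnS [in RHS]leq_eqVlt => /negbTE ->.
apply/setP => i; rewrite !inE; have [->|/d ->] := eqVneq i (Ordinal kN).
  apply/negP => /eqP h; move/eqP: ne; apply; apply/ffunP => j.
  by have [->//|/d] := eqVneq j (Ordinal kN).
by rewrite eqxx.
Qed.

(** Zero energy would make the potential constant, although it is [0] on [A]
and [1] on [B]. *)
Lemma flux_gt0 H A B : (0 < N)%N -> [disjoint A & B]%B ->
  (exists a : S, a \in A) -> (exists b : S, b \in B) ->
  0 < flux (conductance H) A (equilibrium_potential (metropolis beta H) A B).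
Proof.
move=> N0 AB [a aA] [b bB]; set g := equilibrium_potential _ A B.
have gA x : x \in A -> g x = 0 by exact: equilibrium_potential0.
have gB x : x \in B -> g x = 1 by exact: equilibrium_potential1.
have := dirichlet_flux (conductance_sym H) gA gB
  (@equilibrium_potential_harmonic H A B).
set C := flux _ _ _ => DC.
have sq_ge0 x y : 0 <= conductance H x y * (g y - g x) * (g y - g x).
  by rewrite -mulrA mulr_ge0 ?conductance_ge0// -expr2 sqr_ge0.
have C0 : 0 <= C.
  rewrite -(@pmulr_rge0 _ 2)// -DC.
  by rewrite sumr_ge0// => x _; rewrite sumr_ge0.
rewrite lt_neqAle C0 andbT eq_sym; apply/eqP => CE.
have gconst : g a = g b.
  apply: one_flip_invariant_const => x y xy.
  move/eqP: DC; rewrite CE mulr0 psumr_eq0; last by move=> z _; rewrite sumr_ge0.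
  move=> /allP/(_ x); rewrite mem_index_enum => /(_ erefl)/=.
  rewrite psumr_eq0 => [|z _]; last exact: sq_ge0.
  move=> /allP/(_ y); rewrite mem_index_enum => /(_ erefl)/=.
  rewrite /conductance xy -mulrA mulf_eq0 mulf_eq0 invr_eq0 pnatr_eq0.
  rewrite gtn_eqF//= gt_eqF ?expR_gt0//= -expr2 sqrf_eq0 subr_eq0.
  by move/eqP.
by move/eqP: gconst; rewrite gA// gB// eq_sym oner_eq0.
Qed.

(** The weights [w] are the shares of the energy of the network of [H'] carried
by the edges. They are chosen before [H]; this is what allows, for random [H],
to take expectations edge by edge. *)
Lemma capacity_comparison H' A B : (0 < N)%N -> [disjoint A & B]%B ->
  (exists a : S, a \in A) -> (exists b : S, b \in B) ->
  exists w : S -> S -> R,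
    [/\ forall x y, 0 <= w x y, forall x y, ~~ one_flip x y -> w x y = 0,
      \sum_x \sum_y w x y = 1 & forall H,
      1 <= (\sum_x \sum_y
             w x y * expR (beta * Num.max (H x - H' x) (H y - H' y))) *
        ((partition_function beta H * capacity beta H A B) /
         (partition_function beta H' * capacity beta H' A B))].
Proof.
move=> N0 AB aA bB.
set g := equilibrium_potential (metropolis beta H') A B.
have gA x : x \in A -> g x = 0 by exact: equilibrium_potential0.
have gB x : x \in B -> g x = 1 by exact: equilibrium_potential1.
have gharm x : x \notin A -> x \notin B ->
    \sum_y conductance H' x y * (g y - g x) = 0.
  exact: equilibrium_potential_harmonic.
have C'0 : 0 < flux (conductance H') A g by exact: flux_gt0.
set C' := flux _ _ _ in C'0.
pose w x y := conductance H' x y * (g y - g x) ^+ 2 / (2 * C').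
have key H : [/\ forall x y, 0 <= w x y, \sum_x \sum_y w x y = 1 &
    C' <= (\sum_x \sum_y w x y *
        expR (beta * (Num.max (H x) (H y) - Num.max (H' x) (H' y)))) *
      (partition_function beta H * capacity beta H A B)].
  rewrite capacity_flux.
  set f := equilibrium_potential (metropolis beta H) A B.
  pose r x y := expR (beta * (Num.max (H x) (H y) - Num.max (H' x) (H' y))).
  apply: (@flux_comparison _ _ (conductance H) (conductance H') r A B) => //.
  - exact: conductance_ge0.
  - exact: conductance_sym.
  - exact: conductance_sym.
  - by move=> x y; exact: expR_gt0.
  - move=> x y; rewrite /conductance /r; case: ifP => _; last by rewrite mulr0.
    by rewrite mulrCA -expRD; congr (_ * expR _); ring.
  - by move=> x; exact: equilibrium_potential0.
  - by move=> x; exact: equilibrium_potential1.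
  - by move=> x xA xB; exact: equilibrium_potential_harmonic.
exists w; have [w0 w1 _] := key H'; split => //.
  by move=> x y /negbTE xy; rewrite /w /conductance xy !mul0r.
move=> H; have [_ _ le1] := key H.
set C := partition_function beta H * _ in le1 *.
rewrite (capacity_flux H') -/C'.
set X := \sum_x _; set Y := \sum_x _ in le1.
have YX : Y <= X.
  apply: ler_sum => x _; apply: ler_sum => y _.
  rewrite ler_wpM2l// ler_expR ler_pM2l//.
  by case: (leP (H x) (H y)) => ?; case: (leP (H' x) (H' y)) => ?;
    case: (leP (H x - H' x) (H y - H' y)) => ?; lra.
have Y0 : 0 <= Y.
  by apply: sumr_ge0 => x _; apply: sumr_ge0 => y _; rewrite mulr_ge0 ?expR_ge0.
have YC : 0 < Y * C by exact: lt_le_trans le1.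
have C0 : 0 <= C.
  by rewrite leNgt; apply/negP => C0; move: YC; rewrite ltNge mulr_ge0_le0// ltW.
by rewrite mulrA ler_pdivlMr// mul1r (le_trans le1)// ler_wpM2r.
Qed.

End metropolis_capacity.

Section magnetization_levels.
Context {R : realType} {N : nat}.

Lemma magnetization_level_nonempty (m : R) : (0 < N)%N -> Gamma N m ->
  exists s : configuration N, s \in magnetization_level N m.
Proof.
move=> N0 [k kN ->]; exists [ffun i : 'I_N => (i < k)%N].
rewrite inE /magnetization; apply/eqP.
have -> : \sum_i spin [ffun i : 'I_N => (i < k)%N] i =
    \sum_(i < N) (2 * (i < k)%:R - 1) :> R.
  by apply: eq_bigr => i _; rewrite /spin ffunE; case: ltnP => _ /=; ring.
rewrite sumrB -mulr_sumr sumr_const card_ord.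
have -> : \sum_(i < N) (i < k)%:R = k%:R :> R.
  rewrite -natr_sum; congr (_%:R); rewrite -[RHS]card_ord -sum1_card.
  rewrite [RHS](big_ord_widen N (fun=> 1%N))// [RHS]big_mkcond.
  by apply: eq_bigr => i _; case: ltnP.
by field; rewrite pnatr_eq0 -lt0n.
Qed.

Lemma magnetization_level_disjoint (m1 m2 : R) : m1 <> m2 ->
  [disjoint @magnetization_level R N m1 & magnetization_level N m2]%B.
Proof.
move=> m12; rewrite -setI_eq0; apply/eqP/setP => s; rewrite !inE.
by apply/negP => /andP[/eqP h1 /eqP h2]; apply: m12; rewrite -h1 -h2.
Qed.

End magnetization_levels.

(** * Exponential moments of sums of Bernoulli variables *)

Section real_exponential.
Context {R : realType}.
Implicit Types x k r z : R.

(** Bernoulli's inequality [1 + k (y - 1) <= y^k] at [y = exp z], for a real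
exponent; it follows from convexity of the exponential between [k z] and
[0]. *)
Lemma expR_bernoulli k z : 1 <= k -> 1 + k * (expR z - 1) <= expR (k * z).
Proof.
move=> k1; have k0 : 0 < k by lra.
have k01 : 0 <= k^-1 <= 1 by rewrite invr_ge0 ltW//= invf_le1.
pose t : {i01 R} := Itv01 (andP k01).1 (andP k01).2.
have := convex_expR t (k * z) 0.
rewrite !convex.convRE /= expR0 mulr0 addr0 mulKf ?gt_eqF// mulr1 /unstable.onem => h.
have := ler_wpM2l (ltW k0) h.
have -> : k * (k^-1 * expR (k * z) + (1 - k^-1)) = expR (k * z) + k - 1.
  by field; rewrite gt_eqF.
by lra.
Qed.

(** The constant [1 / 2] is what makes the variance of the couplings, hence
the exact [alpha], appear in [bernoulli_mgf]; Hoeffding's lemma would give a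
larger one in general. The remainder of the series is dominated term by term because
[(n + 2)! >= 2 * n!]. *)
Lemma expR_le_quadratic x : expR x <= 1 + x + x ^+ 2 / 2 * expR `|x|.
Proof.
have cvg_l : series (exp_coeff x) n.+2 @[n --> \oo] --> expR x.
  rewrite (cvg_shiftS (fun n => series (exp_coeff x) n.+1)) cvg_shiftS.
  exact: is_cvg_series_exp_coeff.
have cvg_r : (1 + x + x ^+ 2 / 2 * series (exp_coeff `|x|) n) @[n --> \oo] -->
    1 + x + x ^+ 2 / 2 * expR `|x|.
  apply: cvgD; first exact: cvg_cst.
  by apply: cvgMr; exact: is_cvg_series_exp_coeff.
apply: (ler_cvg_to cvg_l cvg_r); apply: nearW => n.
rewrite /series/= !big_nat_recl//= /exp_coeff/= expr0 fact0 invr1 mulr1 expr1.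
rewrite mulr1 addrA lerD2l mulr_sumr.
apply: ler_sum => i _.
rewrite (le_trans (ler_norm _))// normrM normfV normr_nat normrX.
rewrite -[leRHS]mulrACA -[x ^+ 2]real_normK ?num_real// -exprD add2n.
rewrite -invfM ler_wpM2l ?exprn_ge0// lef_pV2 ?posrE ?mulr_gt0 ?ltr0n ?fact_gt0//.
rewrite -natrM ler_nat 2!factS mulnA leq_mul2r; apply/orP; right.
by rewrite -[leqLHS]/(2 * 1)%N leq_mul.
Qed.

(** Replaces a positive part by exponentials of linear functions,
whose expectations factorize over the bonds. When the exponential moments of [z]
are bounded, the second term has a small mean for [r] large. *)
Lemma expR_pospart r z : 1 <= r ->
  expR (Num.max 0 z) <= 1 + expR (r * z) / r.
Proof.
move=> r1; have r0 : 0 < r by lra.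
have h := expR_bernoulli z r1.
have e0 := expR_gt0 (r * z).
case: (leP 0 z) => z0.
  by rewrite -lerBlDl ler_pdivlMr//; lra.
by rewrite expR0 lerDl divr_ge0// ltW.
Qed.

End real_exponential.

Section bernoulli_product.
Context {R : realType} (p : R) {N : nat}.
Hypothesis p01 : 0 < p < 1.
Implicit Types (J : couplings N) (f : couplings N -> R).

Definition PJ_mean f : R :=
  \sum_(J : couplings N) (\prod_(e : bond N) bernoulli_pmf p (J e)) * f J.

Let weight_ge0 J : 0 <= \prod_(e : bond N) bernoulli_pmf p (J e).
Proof.
move: p01 => /andP[p0 p1]; apply: prodr_ge0 => e _.
by apply: bernoulli_pmf_ge0; rewrite !ltW.
Qed.

Lemma PJ_meanZl a f : PJ_mean (fun J => a * f J) = a * PJ_mean f.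
Proof. by rewrite mulr_sumr; apply: eq_bigr => J _; rewrite mulrCA. Qed.

Lemma PJ_meanD f g : PJ_mean (fun J => f J + g J) = PJ_mean f + PJ_mean g.
Proof. by rewrite -big_split; apply: eq_bigr => J _; rewrite mulrDr. Qed.

Lemma PJ_mean_sum (I : finType) (F : I -> couplings N -> R) :
  PJ_mean (fun J => \sum_i F i J) = \sum_i PJ_mean (F i).
Proof.
by rewrite exchange_big; apply: eq_bigr => J _; rewrite mulr_sumr.
Qed.

Lemma PJ_mean_le f g : (forall J, f J <= g J) -> PJ_mean f <= PJ_mean g.
Proof. by move=> fg; apply: ler_sum => J _; rewrite ler_wpM2l. Qed.

Lemma PJ_mean_prod (F : bond N -> bool -> R) :
  PJ_mean (fun J => \prod_e F e (J e)) =
  \prod_e (p * F e true + (1 - p) * F e false).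
Proof.
transitivity (\sum_(J : couplings N)
    \prod_(e : bond N) (bernoulli_pmf p (J e) * F e (J e))).
  by apply: eq_bigr => J _; rewrite big_split.
rewrite -(bigA_distr_bigA (fun e b => bernoulli_pmf p b * F e b))/=.
by apply: eq_bigr => e _; rewrite big_bool.
Qed.

Lemma PJ_mean1 : PJ_mean (fun=> 1) = 1.
Proof.
have := PJ_mean_prod (fun _ _ => 1).
rewrite (_ : (fun J => _) = fun=> 1) => [->|]; last first.
  by apply/funext => J; rewrite big1.
by rewrite big1// => e _; ring.
Qed.

Lemma PJ_complement (E : pred (couplings N)) :
  PJ p E = 1 - PJ_mean (fun J => (~~ E J)%:R).
Proof.
rewrite -[X in X - _]PJ_mean1 /PJ_mean -sumrB /PJ big_mkcond; apply: eq_bigr => J _.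
by case: (E J); rewrite /= ?mulr0 ?subr0 ?mulr1 ?subrr.
Qed.

Lemma bernoulli_mgf a t : `|a| <= t ->
  p * expR (a * (1 - p)) + (1 - p) * expR (a * (0 - p)) <=
  expR (a ^+ 2 * (p * (1 - p) / 2 * expR t)).
Proof.
move: p01 => /andP[p0 p1] at_.
apply: le_trans (expR_ge1Dx _).
have h b : `|b| <= 1 -> expR (a * b) <= 1 + a * b + (a * b) ^+ 2 / 2 * expR t.
  move=> b1; apply: le_trans (expR_le_quadratic _) _.
  rewrite lerD2l ler_wpM2l ?divr_ge0 ?sqr_ge0// ler_expR normrM.
  by rewrite (le_trans _ at_)// ler_piMr.
have /h h1 : `|1 - p| <= 1 by rewrite ler_norml; lra.
have /h h2 : `|0 - p| <= 1 by rewrite ler_norml; lra.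
have {}h1 := ler_wpM2l (ltW p0) h1.
have p1' : 0 <= 1 - p by lra.
have {}h2 := ler_wpM2l p1' h2.
apply: le_trans (lerD h1 h2) _.
by rewrite le_eqVlt; apply/orP; left; apply/eqP; field.
Qed.

(** The expectation factorizes over the independent bonds, and each factor is
controlled by [bernoulli_mgf]. *)
Lemma PJ_mgf (a : bond N -> R) t : (forall e, `|a e| <= t) ->
  PJ_mean (fun J => expR (\sum_e a e * ((J e)%:R - p))) <=
  expR ((\sum_e a e ^+ 2) * (p * (1 - p) / 2 * expR t)).
Proof.
move=> at_.
have -> : (fun J : couplings N => expR (\sum_e a e * ((J e)%:R - p))) =
    (fun J => \prod_e expR (a e * ((J e)%:R - p))).
  by apply/funext => J; rewrite expR_sum.
rewrite (PJ_mean_prod (fun e (b : bool) => expR (a e * (b%:R - p)))).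
rewrite mulr_suml expR_sum; apply: ler_prod => e _; apply/andP; split.
  by move: p01 => /andP[p0 p1]; rewrite addr_ge0 ?mulr_ge0 ?expR_ge0 ?subr_ge0 ?ltW.
exact: bernoulli_mgf.
Qed.

End bernoulli_product.

(** * Deviation of the dilute Hamiltonian from its mean *)

Section dilute_deviation.
Context {R : realType} {N : nat}.
Local Notation S := (configuration N).
Implicit Types (s t : S) (e : bond N) (J : couplings N).

Lemma sum_bond (F : 'I_N * 'I_N -> R) :
  \sum_(e : bond N) F (val e) = \sum_(i < N) \sum_(j < N | (i < j)%N) F (i, j).
Proof.
rewrite pair_big_dep/=.
rewrite (reindex_omap (fun e : bond N => val e) insub) => [|[i j] /= ij].
  apply: eq_big => [e|e _]; last exact: (congr1 F (surjective_pairing (sval e))).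
  by rewrite valK eqxx andbT (valP e).
by rewrite insubT.
Qed.

Lemma card_bond_le : (\sum_(e : bond N) 1 : R) <= N%:R ^+ 2 / 2.
Proof.
rewrite (sum_bond (fun=> 1)).
have swap : \sum_(i < N) \sum_(j < N | (i < j)%N) (1 : R) =
    \sum_(i < N) \sum_(j < N | (j < i)%N) 1.
  by rewrite !pair_big_dep/= (reindex_inj (inv_inj (@swap_pairK _ _))).
rewrite ler_pdivlMr// mulr_natr mulr2n {2}swap -big_split/=.
apply: (@le_trans _ _ (\sum_(i < N) \sum_(j < N) (1 : R))).
  apply: ler_sum => i _.
  rewrite (big_mkcond (fun j : 'I_N => (i < j)%N)) (big_mkcond (fun j : 'I_N => (j < i)%N)).
  rewrite -big_split/=; apply: ler_sum => j _.
  by case: ltngtP; rewrite ?addr0 ?add0r.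
by rewrite !sumr_const !card_ord -mulrnA -[in leRHS]natrX mulnn.
Qed.

Definition bond_spin s e : R := spin s (val e).1 * spin s (val e).2.

Lemma bond_spin_sqr s e : bond_spin s e ^+ 2 = 1.
Proof.
have sq i : @spin R N s i ^+ 2 = 1 by rewrite /spin; case: (s i); ring.
by rewrite /bond_spin exprMn !sq mulr1.
Qed.

Lemma bond_spin_norm s e : `|bond_spin s e| = 1.
Proof.
by apply/eqP; rewrite -(@eqrXn2 _ 2)// real_normK ?num_real// bond_spin_sqr expr1n.
Qed.

Lemma one_flip_extrapolation_norm (r : R) s t e : 0 <= r ->
  `|bond_spin s e + r * (bond_spin t e - bond_spin s e)| <= 1 + 2 * r.
Proof.
move=> r0; apply: le_trans (ler_normD _ _) _.
rewrite bond_spin_norm lerD2l normrM ger0_norm// mulrC ler_wpM2r//.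
by apply: le_trans (ler_normB _ _) _; rewrite !bond_spin_norm; lra.
Qed.

(** Off the flipped spin both configurations have the same bond spins, so these
coefficients are signs except on the order [N] bonds at that spin: their number
does not affect the leading term [N^2 / 2]. *)
Lemma one_flip_extrapolation_sqr (r : R) s t : 0 <= r -> one_flip s t ->
  \sum_e (bond_spin s e + r * (bond_spin t e - bond_spin s e)) ^+ 2 <=
  N%:R ^+ 2 / 2 + 2 * N%:R * (1 + 2 * r) ^+ 2.
Proof.
move=> r0 /cards1P[i0 sti0].
have st i : i != i0 -> @spin R N s i = spin t i.
  move=> ii0; rewrite /spin; suff -> : s i = t i by [].
  by have /setP/(_ i) := sti0; rewrite !inE (negbTE ii0) => /negbFE/eqP.
pose F (ij : 'I_N * 'I_N) : R :=
  ((ij.1 == i0)%:R + (ij.2 == i0)%:R) * (1 + 2 * r) ^+ 2.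
apply: (@le_trans _ _ (\sum_(e : bond N) (1 + F (val e)))).
  apply: ler_sum => e _; rewrite /F.
  have le2 : (bond_spin s e + r * (bond_spin t e - bond_spin s e)) ^+ 2 <=
      (1 + 2 * r) ^+ 2.
    rewrite -real_normK ?num_real// lerXn2r ?nnegrE ?normr_ge0//; first by lra.
    exact: one_flip_extrapolation_norm.
  have sq0 : 0 <= (1 + 2 * r) ^+ 2 by exact: sqr_ge0.
  have [e1|/st e1] := eqVneq (val e).1 i0.
    by case: (_ == _); rewrite /= ?mulr1n ?mulr0n; lra.
  have [e2|/st e2] := eqVneq (val e).2 i0.
    by rewrite /= ?mulr1n ?mulr0n; lra.
  rewrite {2}/bond_spin -e1 -e2 subrr mulr0 addr0 bond_spin_sqr.
  by rewrite addr0 mul0r addr0.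
rewrite big_split/= lerD ?card_bond_le// (sum_bond F).
apply: (@le_trans _ _ (\sum_(i < N) \sum_(j < N) F (i, j))).
  apply: ler_sum => i _; rewrite [leLHS]big_mkcond/=; apply: ler_sum => j _.
  by case: ifP => // _; rewrite mulr_ge0 ?sqr_ge0// addr_ge0.
under eq_bigr do rewrite -mulr_suml.
rewrite -mulr_suml ler_wpM2r ?sqr_ge0//.
under eq_bigr do rewrite big_split/=.
rewrite big_split/=.
have one (i : 'I_N) : \sum_(j < N) (j == i)%:R = 1 :> R.
  by rewrite (bigD1 i)//= eqxx big1 ?addr0// => j /negbTE ->.
have -> : \sum_(i < N) \sum_(j < N) (i == i0)%:R = N%:R :> R.
  rewrite exchange_big/=; under eq_bigr do rewrite one.
  by rewrite sumr_const card_ord.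
have -> : \sum_(i < N) \sum_(j < N) (j == i0)%:R = N%:R :> R.
  under eq_bigr do rewrite one.
  by rewrite sumr_const card_ord.
by lra.
Qed.

Variables p h : R.
Hypothesis p01 : 0 < p < 1.
Hypothesis N_gt0 : (0 < N)%N.

Definition H_deviation J s : R := H_dilute p h J s - H_CW N h s.

Lemma H_deviationE J s : H_deviation J s =
  - (N%:R * p)^-1 * \sum_e bond_spin s e * ((J e)%:R - p).
Proof.
have -> : \sum_e bond_spin s e * ((J e)%:R - p) =
    \sum_(e : bond N) (J e)%:R * spin s (val e).1 * spin s (val e).2 -
    p * \sum_(e : bond N) spin s (val e).1 * spin s (val e).2.
  rewrite mulr_sumr -sumrB; apply: eq_bigr => e _.
  by rewrite /bond_spin; ring.
rewrite /H_deviation /H_dilute /H_CW; field.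
by rewrite pnatr_eq0 -lt0n N_gt0 gt_eqF//; case/andP: p01.
Qed.

(** The extrapolation [D s + r * (D t - D s)] is linear in the couplings.
As [N] tends to infinity the bound tends to [exp (k^2 (1 - p) / (4 p))] for any
fixed [r]; the cases [r = 0] and [r > 1] together control the maximum of [D s]
and [D t]. Here [D] is the deviation of the Hamiltonian. *)
Lemma H_deviation_mgf (k r : R) s t : 0 <= k -> 0 <= r -> one_flip s t ->
  PJ_mean p (fun J => expR (k *
    (H_deviation J s + r * (H_deviation J t - H_deviation J s)))) <=
  expR (k ^+ 2 * (1 - p) / (4 * p) * (1 + 4 * (1 + 2 * r) ^+ 2 / N%:R)
        * expR (k * (1 + 2 * r) / (N%:R * p))).
Proof.
move=> k0 r0 st; have /andP[p0 p1] := p01.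
have N0 : 0 < N%:R :> R by rewrite ltr0n.
have Np0 : 0 < N%:R * p by rewrite mulr_gt0.
pose x e := bond_spin s e + r * (bond_spin t e - bond_spin s e).
pose a e := - (k / (N%:R * p)) * x e.
have -> : (fun J => expR (k *
    (H_deviation J s + r * (H_deviation J t - H_deviation J s)))) =
    (fun J => expR (\sum_e a e * ((J e)%:R - p))).
  apply/funext => J; congr expR; rewrite !H_deviationE -mulrBr -sumrB.
  rewrite mulrCA -mulrDr mulr_sumr -big_split/= !mulr_sumr.
  by apply: eq_bigr => e _; rewrite /a /x; field; rewrite !gt_eqF.
have k'0 : 0 <= k / (N%:R * p) by rewrite divr_ge0// ltW.
have a_le e : `|a e| <= k * (1 + 2 * r) / (N%:R * p).
  rewrite /a normrM normrN (ger0_norm k'0) [leRHS]mulrAC ler_wpM2l//.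
  exact: one_flip_extrapolation_norm.
apply: le_trans (PJ_mgf p01 a_le) _; rewrite ler_expR.
set E := expR _; rewrite mulrA ler_wpM2r ?expR_ge0//.
have -> : \sum_e a e ^+ 2 = (k / (N%:R * p)) ^+ 2 * \sum_e x e ^+ 2.
  by rewrite mulr_sumr; apply: eq_bigr => e _; rewrite /a exprMn sqrrN.
have -> : k ^+ 2 * (1 - p) / (4 * p) * (1 + 4 * (1 + 2 * r) ^+ 2 / N%:R) =
    (k / (N%:R * p)) ^+ 2 * (N%:R ^+ 2 / 2 + 2 * N%:R * (1 + 2 * r) ^+ 2)
    * (p * (1 - p) / 2).
  by field; rewrite !gt_eqF.
rewrite ler_wpM2r ?divr_ge0 ?mulr_ge0 ?(ltW p0)//; first by lra.
by rewrite ler_wpM2l ?sqr_ge0//; exact: one_flip_extrapolation_sqr.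
Qed.

End dilute_deviation.

Section uniform_moment_bound.
Context {R : realType}.
Variables p : R.
Hypothesis p01 : 0 < p < 1.

Lemma mgf_exponent_cvg (k c : R) :
  k ^+ 2 * (1 - p) / (4 * p) * (1 + 4 * c ^+ 2 / N%:R)
    * expR (k * c / (N%:R * p)) @[N --> \oo] --> k ^+ 2 * (1 - p) / (4 * p).
Proof.
have invN0 : (N%:R : R)^-1 @[N --> \oo] --> (0 : R).
  apply/gtr0_cvgV0; last exact: cvgr_idn.
  by exists 1%N => // n /= n1; rewrite ltr0n.
have invN c0 : c0 / N%:R @[N --> \oo] --> (0 : R).
  by rewrite -(mulr0 c0); exact: cvgMr.
have c1 : 1 + 4 * c ^+ 2 / N%:R @[N --> \oo] --> (1 + 0 : R).
  by apply: cvgD; [exact: cvg_cst|exact: invN].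
have c2 : expR (k * c / (N%:R * p)) @[N --> \oo] --> (expR 0 : R).
  apply: continuous_cvg; first exact: continuous_expR.
  under eq_fun do rewrite invfM mulrCA mulrC.
  exact: invN.
set L := k ^+ 2 * (1 - p) / (4 * p).
have : L * (1 + 4 * c ^+ 2 / N%:R) * expR (k * c / (N%:R * p)) @[N --> \oo]
    --> L * (1 + 0) * expR 0.
  by apply: cvgM => //; apply: cvgM => //; exact: cvg_cst.
by rewrite expR0 addr0 !mulr1.
Qed.

(** Writing the maximum as [D s + max (0, D t - D s)], [expR_pospart] leaves two
exponentials of linear functions, each of mean at most
[exp (k^2 (1 - p) / (4 p) + k)] for [N] large. The factor [1 + 1 / r] lost on
the way is at most [exp k] as soon as [1 / r <= k]. *)
Lemma H_deviation_max_mgf (k : R) : 0 < k ->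
  \forall N \near \oo, forall h (s t : configuration N), one_flip s t ->
    PJ_mean p (fun J => expR (k *
      Num.max (H_deviation p h J s) (H_deviation p h J t))) <=
    expR (k ^+ 2 * (1 - p) / (4 * p) + 2 * k).
Proof.
move=> k0; set L := k ^+ 2 * (1 - p) / (4 * p).
pose r := 1 + k^-1.
have r0 : 0 < r by rewrite addr_gt0// invr_gt0.
have Lk : L < L + k by rewrite ltrDl.
near=> N => h s t st.
have N0 : (0 < N)%N by near: N; exists 1%N.
pose D := @H_deviation R N p h.
have bound c : 0 <= c -> L * (1 + 4 * (1 + 2 * c) ^+ 2 / N%:R)
      * expR (k * (1 + 2 * c) / (N%:R * p)) <= L + k ->
    PJ_mean p (fun J => expR (k * (D J s + c * (D J t - D J s)))) <= expR (L + k).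
  move=> c0 Lc; apply: le_trans (H_deviation_mgf h p01 N0 (ltW k0) c0 st) _.
  by rewrite ler_expR.
have bound0 := bound 0 (lexx 0).
have boundr := bound r (ltW r0).
have {}bound0 : PJ_mean p (fun J => expR (k * D J s)) <= expR (L + k).
  rewrite (_ : (fun J => _) = fun J => expR (k * (D J s + 0 * (D J t - D J s)))).
    by apply: bound0; near: N; apply: cvgr_le Lk; exact: mgf_exponent_cvg.
  by apply/funext => J; rewrite mul0r addr0.
have {}boundr : PJ_mean p (fun J => expR (k * (D J s + r * (D J t - D J s))))
    <= expR (L + k).
  by apply: boundr; near: N; apply: cvgr_le Lk; exact: mgf_exponent_cvg.
apply: (@le_trans _ _ (PJ_mean p (fun J => expR (k * D J s) +
    r^-1 * expR (k * (D J s + r * (D J t - D J s)))))).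
  apply: PJ_mean_le => // J; rewrite -/(D J s) -/(D J t).
  have -> : Num.max (D J s) (D J t) = D J s + Num.max 0 (D J t - D J s).
    by rewrite addr_maxr addr0 subrKC.
  rewrite mulrDr expRD maxr_pMr ?(ltW k0)// mulr0.
  have r1 : 1 <= r by rewrite lerDl invr_ge0 ltW.
  apply: le_trans (ler_wpM2l (expR_ge0 _) (expR_pospart _ r1)) _.
  rewrite mulrDr mulr1 lerD2l mulrA -expRD mulrC.
  by rewrite [k * (D J s + _)]mulrDr [k * (r * _)]mulrCA.
rewrite PJ_meanD PJ_meanZl.
apply: (@le_trans _ _ ((1 + r^-1) * expR (L + k))).
  by rewrite mulrDl mul1r lerD// ler_wpM2l// invr_ge0 ltW.
have -> : L + 2 * k = k + (L + k) by ring.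
rewrite expRD ler_wpM2r ?expR_ge0// (le_trans (expR_ge1Dx _))// ler_expR.
by rewrite invf_ple ?posrE// lerDr.
Unshelve. all: by end_near.
Qed.

End uniform_moment_bound.

(** * Lower tail of the ratio of capacities *)

(** Chernoff's bound for the average over the edges of [exp (m s t)], where
[m s t] is [beta] times the larger deviation at the two ends. If this average
exceeds [exp T], Bernoulli's inequality makes the average of
[exp (k (m s t - T))] at least [1], so the moment bound on single edges
suffices. *)
Lemma capacity_ratio_tail (R : realType) (N : nat) (p beta h k T M : R)
    (A B : {set configuration N}) :
  0 < p < 1 -> 0 < beta -> 1 <= k -> (0 < N)%N -> [disjoint A & B]%B ->
  (exists a : configuration N, a \in A) ->
  (exists b : configuration N, b \in B) ->
  (forall s t : configuration N, one_flip s t ->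
    PJ_mean p (fun J => expR (k * beta *
      Num.max (H_deviation p h J s) (H_deviation p h J t))) <= expR M) ->
  1 - expR (M - k * T) <=
  PJ p (fun J : couplings N => expR (- T) <=
    (partition_function beta (H_dilute p h J)
       * capacity beta (H_dilute p h J) A B)
    / (partition_function beta (H_CW N h) * capacity beta (H_CW N h) A B)).
Proof.
move=> p01 beta0 k1 N0 AB aA bB mgf.
have [w [w0 wflip w1 ratio_ge]] := capacity_comparison beta0 (H_CW N h) N0 AB aA bB.
rewrite PJ_complement// lerD2l lerN2.
pose m J s t := beta * Num.max (@H_deviation R N p h J s) (H_deviation p h J t).
pose F J := \sum_s \sum_t w s t * expR (k * (m J s t - T)).
apply: (@le_trans _ _ (PJ_mean p F)).
  apply: PJ_mean_le => // J; case: (leP (expR (- T)) (_ / _)) => [_|ratio_lt] /=.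
    apply: sumr_ge0 => s _; apply: sumr_ge0 => t _.
    by rewrite mulr_ge0 ?expR_ge0.
  set X := \sum_s \sum_t w s t * expR (m J s t).
  have X0 : 0 <= X.
    apply: sumr_ge0 => s _; apply: sumr_ge0 => t _.
    by rewrite mulr_ge0 ?expR_ge0.
  have XT : 1 <= X * expR (- T).
    apply: (le_trans (ratio_ge (H_dilute p h J))).
    by rewrite ler_wpM2l// ltW.
  apply: (@le_trans _ _ (1 + k * (X * expR (- T) - 1))).
    by rewrite lerDl mulr_ge0//; lra.
  have -> : 1 + k * (X * expR (- T) - 1) =
      \sum_s \sum_t w s t * (1 + k * (expR (m J s t - T) - 1)).
    transitivity ((1 - k) * (\sum_s \sum_t w s t) + k * expR (- T) * X).
      by rewrite w1; ring.
    rewrite /X !mulr_sumr -big_split/=; apply: eq_bigr => s _.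
    rewrite !mulr_sumr -big_split/=; apply: eq_bigr => t _.
    by rewrite expRD; ring.
  apply: ler_sum => s _; apply: ler_sum => t _.
  by rewrite ler_wpM2l// expR_bernoulli.
rewrite /F PJ_mean_sum -[leRHS]mul1r -w1 mulr_suml.
apply: ler_sum => s _; rewrite PJ_mean_sum mulr_suml.
apply: ler_sum => t _; rewrite PJ_meanZl.
have [st|/wflip ->] := boolP (one_flip s t); last by rewrite !mul0r.
rewrite ler_wpM2l// addrC expRD.
rewrite (_ : (fun J => _) = fun J => expR (- (k * T)) * expR (k * beta *
    Num.max (H_deviation p h J s) (H_deviation p h J t))); last first.
  by apply/funext => J; rewrite -expRD /m; congr expR; ring.
by rewrite PJ_meanZl ler_wpM2l ?expR_ge0// mgf.
Qed.

Theorem theorem1p5 (R : realType) (p beta : R)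
    (hp : 0 < p < 1) (hbeta : 0 < beta) :
  exists k1 k2 : R, [/\ 0 < k1, 0 < k2 &
    forall h s : R, 0 < h -> 0 < s ->
    let alpha := beta ^+ 2 * (1 - p) / (4 * p) in
    exists2 eps : nat -> R, eps n @[n --> \oo] --> 0 &
      \forall N \near \oo, forall m1 m2 : R,
        Gamma N m1 -> Gamma N m2 -> m1 <> m2 ->
        let A := magnetization_level N m1 in
        let B := magnetization_level N m2 in
        PJ p (fun J : couplings N =>
          (partition_function beta (H_dilute p h J)
             * capacity beta (H_dilute p h J) A B)
          / (partition_function beta (H_CW N h)
               * capacity beta (H_CW N h) A B)
          >= expR (- (s + 2 * beta * (1 + h) + alpha)) * (1 + eps N))
        >= 1 - k1 * expR (- (k2 * s ^+ 2))].
Proof.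
have /andP[p0 p1] := hp.
have alpha0 : 0 < beta ^+ 2 * (1 - p) / (4 * p).
  have q0 : 0 < 1 - p by rewrite subr_gt0.
  by rewrite divr_gt0 ?mulr_gt0 ?exprn_gt0.
set a := beta ^+ 2 * (1 - p) / (4 * p) in alpha0.
exists 1, (4 * a)^-1; split => //; first by rewrite invr_gt0 mulr_gt0.
move=> h s h0 s0 /=.
rewrite -/a; exists (fun=> 0); first exact: cvg_cst.
pose k := 1 + s / (2 * a).
have s2a : 0 < s / (2 * a) by rewrite divr_gt0// mulr_gt0.
have k1 : 1 <= k by rewrite lerDl ltW.
have k0 : 0 < k by lra.
have kb0 : 0 < k * beta by rewrite mulr_gt0.
near=> N => m1 m2 Gm1 Gm2 m12.
have N0 : (0 < N)%N by near: N; exists 1%N.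
rewrite addr0 mulr1 mul1r.
set T := s + _ + _.
apply: le_trans (capacity_ratio_tail T hp hbeta k1 N0
  (magnetization_level_disjoint m12)
  (magnetization_level_nonempty N0 Gm1) (magnetization_level_nonempty N0 Gm2)
  (_ : forall x y : configuration N, one_flip x y -> _ <=
    expR ((k * beta) ^+ 2 * (1 - p) / (4 * p) + 2 * (k * beta)))); last first.
  move=> x y; move: x y; near: N; have := H_deviation_max_mgf hp kb0.
  by apply: filterS => N; apply.
rewrite lerD2l lerN2 ler_expR.
have -> : (k * beta) ^+ 2 * (1 - p) / (4 * p) = k ^+ 2 * a.
  by rewrite /a; field; rewrite gt_eqF.
have ka : (k - 1) * a = s / 2.
  by rewrite /k; field; rewrite gt_eqF.
have -> : k ^+ 2 * a + 2 * (k * beta) - k * T =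
    - (s / 2 * k + 2 * (k * beta * h)).
  have -> : k ^+ 2 * a = k * ((k - 1) * a) + k * a by ring.
  by rewrite ka /T; field.
rewrite lerN2.
have -> : (4 * a)^-1 * s ^+ 2 = s / 2 * (s / (2 * a)).
  by field; rewrite gt_eqF.
rewrite ler_wpDr//; first by rewrite !mulr_ge0// ltW.
by rewrite ler_wpM2l ?divr_ge0 ?(ltW s0)// lerDr.
Unshelve. all: by end_near.
Qed.
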